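(* Let $X$ be a complex separable Fréchet space and $T$ an invertible continuous linear operator on $X$ with discrete spectrum, i.e. $\overline{\mathrm{span}(\mathcal{E}(T))}=X$ where $\mathcal{E}(T)=\{x\in X:Tx=\lambda x\text{ for some }\lambda\in\mathbb{T}\}$. Then $T$ is hyper-recurrent and $\mathrm{Hr}(T)$ is dense in $X$.
   Context: $\mathbb{T}$ is the unit circle in $\mathbb{C}$. For a continuous linear operator $T$ on a Fréchet space $X$: $x$ is recurrent if $T^{\omega_n}x\to x$ for some strictly increasing sequence $(\omega_n)$ of positive integers; $\mathrm{Rec}(T)$ is the set of recurrent vectors and $T$ is recurrent if $\mathrm{Rec}(T)$ is dense. $\mathfrak{C}$ is the set of strictly increasing sequences $\omega$ with $T^{\omega_n}x\to x$ for some $x\ne0$; $\mathfrak{L}(\omega)=\{x:T^{\omega_n}x\to x\}$. $\mathrm{Hr}(T)$ is the set of $x\in\mathrm{Rec}(T)$ such that $\mathfrak{L}(\omega)$ is dense for every $\omega\in\mathfrak{C}$ with $x\in\mathfrak{L}(\omega)$; a recurrent $T$ is hyper-recurrent if $\mathrm{Hr}(T)\ne\emptyset$. *)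

(* Defs.v *)
From HB Require Import structures.
From mathcomp Require Import all_boot all_order all_algebra.
From mathcomp Require Import complex.
From mathcomp Require Import all_classical all_reals topology normedtype tvs.

Set Implicit Arguments.
Unset Strict Implicit.
Unset Printing Implicit Defensive.

Import Order.TTheory GRing.Theory Num.Theory.
Local Open Scope classical_set_scope.
Local Open Scope ring_scope.

Section Defs.
Context {K : numFieldType} {X : tvsType K}.

Definition lspan (A : set X) : set X :=
  [set x | exists (n : nat) (c : 'I_n -> K) (v : 'I_n -> X),
      (forall i, A (v i)) /\ x = \sum_(i < n) c i *: v i].

Definition unimod_eigenvectors (T : X -> X) : set X :=
  [set x | exists l : K, `|l| = 1 /\ T x = l *: x].

Definition incr_pos_seq (w : nat -> nat) : Prop :=
  (forall n, (0 < w n)%N) /\ (forall m n, (m < n)%N -> (w m < w n)%N).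

Definition Lset (T : X -> X) (w : nat -> nat) : set X :=
  [set x | (fun n => iter (w n) T x) @ \oo --> x].

Definition recurrent_vector (T : X -> X) (x : X) : Prop :=
  exists w, incr_pos_seq w /\ Lset T w x.

Definition Rec (T : X -> X) : set X := [set x | recurrent_vector T x].

Definition recurrent (T : X -> X) : Prop := closure (Rec T) = setT.

Definition Cseq (T : X -> X) : set (nat -> nat) :=
  [set w | incr_pos_seq w /\ exists x, x != 0 /\ Lset T w x].

Definition Hr (T : X -> X) : set X :=
  [set x | Rec T x /\
     forall w, Cseq T w -> Lset T w x -> closure (Lset T w) = setT].

Definition hyper_recurrent (T : X -> X) : Prop :=
  recurrent T /\ Hr T !=set0.

(** Fréchet space: (locally convex tvs, as in tvsType) Hausdorff, metrizable
    (countably based uniformity) and complete. *)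
Definition frechet : Prop :=
  [/\ hausdorff_space X, countable_uniformity X &
      forall F : set_system X, ProperFilter F -> cauchy F -> exists l : X, F --> l].

Definition separable : Prop :=
  exists D : set X, countable D /\ closure D = setT.

End Defs.

(* Main.v *)
(* Let lam_0, lam_1, ... be countably many unimodular eigenvalues whose eigenvectors
   span a dense subspace, and let x = sum_k u_k be a series with T u_k = lam_k u_k and
   u_k <> 0 for each distinct eigenvalue, whose terms are eventually small enough for
   bounded multipliers to act on it. Simultaneous recurrence of the lam_k on the circle
   makes x recurrent. If T^(w_n) x -> x, Cesaro means of lam_j^-m T^m extract
   (lam_j^(w_n) - 1) u_j -> 0, so lam_j^(w_n) -> 1 for every j and T^(w_n) converges to
   the identity on the span of the eigenvectors. Such x are dense: start from a finite
   sum of eigenvectors and add tiny multiples of the missing ones. *)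

Require Import Defs.
From HB Require Import structures.
From mathcomp Require Import all_boot all_order all_algebra.
From mathcomp Require Import complex.
From mathcomp Require Import all_classical all_reals topology normedtype tvs.
From mathcomp Require Import lra.

Set Implicit Arguments.
Unset Strict Implicit.
Unset Printing Implicit Defensive.

Import Order.TTheory GRing.Theory Num.Theory.
Local Open Scope classical_set_scope.
Local Open Scope ring_scope.

(** * Neighbourhoods of the origin and scalar multiples *)

Section TvsNeighbourhoods.
Context {K : numFieldType} {X : tvsType K}.
Implicit Types (U : set X) (x y z : X).

Lemma nbhs0_add U : nbhs (0 : X) U ->
  exists2 V, nbhs (0 : X) V & forall a b, V a -> V b -> U (a + b).
Proof.
move=> U0; have /= := @add_continuous X (0, 0) U.
rewrite /= addr0 => /(_ U0)[[V W] /= [V0 W0] VWU].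
exists (V `&` W); first exact: filterI.
by move=> a b [Va _] [_ Wb]; exact: (VWU (a, b)).
Qed.

Lemma nbhs_translate x U : nbhs x U <-> nbhs (0 : X) [set z | U (x + z)].
Proof.
split=> h.
  have /= := @add_continuous X (x, 0) U.
  rewrite /= addr0 => /(_ h)[[V W] /= [V0 W0] VWU].
  by apply: filterS W0 => z Wz; apply: (VWU (x, z)); split=> //; exact: nbhs_singleton.
by have := nbhsT x h; apply: filterS => _ [z Uz <-].
Qed.

(** Continuity of scaling at the origin gives a disc of radius [d] and a neighbourhood [W];
    rescaling [W] by [d / (B + B)] trades the radius [d] for the prescribed bound [B]. *)
Lemma nbhs0_scale_bounded (B : K) U : 0 < B -> nbhs (0 : X) U ->
  exists2 V, nbhs (0 : X) V & forall a z, `|a| <= B -> V z -> U (a *: z).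
Proof.
move=> B0 U0; have /= := @scale_continuous K X (0, 0) U.
rewrite /= scaler0 => /(_ U0)[[A W] /= [[d /= d0 dA] W0] AWU].
have c0 : 0 < d / (B + B) by rewrite divr_gt0 ?addr_gt0.
exists ([set z | W ((d / (B + B))^-1 *: z)]).
  have := nbhs0Z (lt0r_neq0 c0) W0; apply: filterS => _ [z Wz <-] /=.
  by rewrite scalerA mulVf ?scale1r ?lt0r_neq0.
move=> a z aB Wz.
have -> : a *: z = (a * (d / (B + B))) *: ((d / (B + B))^-1 *: z).
  by rewrite scalerA mulfK ?lt0r_neq0.
apply: (AWU (_, _)); split=> //=; apply: dA => /=.
rewrite sub0r normrN normrM (gtr0_norm c0).
rewrite (@le_lt_trans _ _ (B * (d / (B + B)))) ?ler_wpM2r ?(ltW c0)//.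
rewrite mulrCA gtr_pMr// ltr_pdivrMr ?addr_gt0// mul1r ltrDl//.
Qed.

Lemma nbhs0_scale_small (v : X) U : nbhs (0 : X) U ->
  exists2 d : K, 0 < d & forall a, `|a| < d -> U (a *: v).
Proof.
move=> U0; have /= := @scale_continuous K X (0, v) U.
rewrite /= scale0r => /(_ U0)[[A W] /= [[d /= d0 dA] W0] AWU].
exists d => // a ad; apply: (AWU (a, v)); split => /=.
  by apply: dA; rewrite /= sub0r normrN.
exact: nbhs_singleton.
Qed.

Lemma nbhs0_sum_small (v : nat -> X) n U : nbhs (0 : X) U ->
  exists2 d : K, 0 < d & forall a : nat -> K, (forall k, (k < n)%N -> `|a k| < d) ->
    U (\sum_(0 <= k < n) a k *: v k).
Proof.
elim: n U => [|n IH] U U0.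
  by exists 1 => // a _; rewrite big_nil; exact: nbhs_singleton.
have [V V0 VU] := nbhs0_add U0.
have [d d0 dV] := IH _ V0.
have [e e0 eV] := nbhs0_scale_small (v n) V0.
have de : d >=< e by rewrite real_comparable ?gtr0_real.
exists (Num.min d e); first by rewrite comparable_lt_min ?d0.
move=> a ha; have {}ha k : (k <= n)%N -> `|a k| < d /\ `|a k| < e.
  by move=> kn; apply/andP; rewrite -comparable_lt_min ?ha.
rewrite big_nat_recr//=; apply: VU; last by apply: eV; case: (ha n).
by apply: dV => k kn; case: (ha k (ltnW kn)).
Qed.

(** Some neighbourhood of [0] omits [v]. If [|b n| >= e], multiplying a small [b n *: v] by
    [(b n)^-1], of modulus at most [e^-1], would put [v] into it. *)
Lemma scaled_seq_cvg0 (v : X) (b : nat -> K) : hausdorff_space X -> v != 0 ->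
  (forall U, nbhs (0 : X) U -> exists N, forall n, (N <= n)%N -> U (b n *: v)) ->
  forall e, 0 < e -> exists N, forall n, (N <= n)%N -> `|b n| < e.
Proof.
move=> hX v0 hb e e0.
have [U U0 Uv] : exists2 U, nbhs (0 : X) U & ~ U v.
  apply: contrapT => h; move/negP: v0; apply; apply/eqP.
  apply: hX => A B Av B0; exists v; split; first exact: nbhs_singleton.
  by apply: contrapT => nBv; apply: h; exists B.
have ei0 : 0 < e^-1 by rewrite invr_gt0.
have [V V0 VU] := nbhs0_scale_bounded ei0 U0.
have [N hN] := hb _ V0.
exists N => n Nn; have [//|] := real_ltP (normr_real (b n)) (gtr0_real e0).
move=> eb; exfalso; apply: Uv.
have bn0 : b n != 0 by rewrite -normr_gt0 (lt_le_trans e0).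
rewrite -(scale1r v) -(mulVf bn0) -scalerA; apply: VU; last exact: hN.
by rewrite normfV lef_pV2 ?posrE ?normr_gt0.
Qed.

End TvsNeighbourhoods.

(** * Unimodular numbers: simultaneous recurrence and Cesaro means *)

Section UnimodularNumbers.
Context {R : realType}.
Local Notation C := R[i].

Lemma complex_gt0_Re (e : C) : 0 < e -> e = (complex.Re e)%:C%C /\ 0 < complex.Re e.
Proof.
case: e => a b; rewrite ltcE /= => /andP[/eqP b0 a0]; split=> //.
by rewrite b0.
Qed.

Lemma exists_invn_lt (e : C) : 0 < e -> exists n : nat, n.+1%:R^-1 < e.
Proof.
move=> /complex_gt0_Re[-> e0].
exists (Num.trunc (complex.Re e)^-1).
have -> : (Num.trunc (complex.Re e)^-1).+1%:R^-1 =
    ((Num.trunc (complex.Re e)^-1).+1%:R^-1)%:C%C :> C.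
  by rewrite fmorphV rmorph_nat.
rewrite ltcR -[ltRHS]invrK ltf_pV2 ?posrE ?invr_gt0 //.
by rewrite truncnS_gt.
Qed.

Lemma complex_norm_lt (z : C) (r : R) :
  `|complex.Re z| < r / 2 -> `|complex.Im z| < r / 2 -> `|z| < r%:C%C.
Proof.
move=> h1 h2.
have r0 : 0 < r by have := normr_ge0 (complex.Re z); lra.
rewrite normc_def ltcR -(gtr0_norm r0) -(sqrtr_sqr r).
rewrite ltr_sqrt ?exprn_gt0//.
have sq (t : R) : `|t| < r / 2 -> t ^+ 2 < (r / 2) ^+ 2.
  by move=> tr; rewrite -(real_normK (num_real t)) ltr_pXn2r ?nnegrE// divr_ge0// ltW.
have := sq _ h1; have := sq _ h2; have : 0 < r ^+ 2 by rewrite exprn_gt0.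
have -> : (r / 2) ^+ 2 = r ^+ 2 / 4 by rewrite expr_div_n; congr (_ / _); rewrite -natrX.
lra.
Qed.

Lemma unimodular_Re_Im (z : C) : `|z| = 1 ->
  `|complex.Re z| <= 1 /\ `|complex.Im z| <= 1.
Proof.
move=> z1; have := add_Re2_Im2 z; rewrite z1 expr1n => -[h].
have := sqr_ge0 (complex.Re z); have := sqr_ge0 (complex.Im z) => i0 r0.
by split; rewrite -(expr_le1 (ltn0Sn 1)) // real_normK ?num_real// -h ?lerDl ?lerDr.
Qed.

(** Cuts [[-1, 1]] into intervals of length [1 / q]; the endpoint [1] gets a cell of its own, whence
    [2 * q + 1] cells. *)
Let cell (q : nat) (x : R) : nat := Num.trunc ((x + 1) * q%:R).

Let cell_le q x : `|x| <= 1 -> (cell q x < (2 * q).+1)%N.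
Proof.
rewrite ler_norml => /andP[_ x1]; rewrite ltnS -(@natrK R (2 * q)).
by apply: le_truncn; rewrite natrM ler_wpM2r// -natr1 lerD2r.
Qed.

Let cell_eq q x y : (0 < q)%N -> `|x| <= 1 -> `|y| <= 1 ->
  cell q x = cell q y -> `|x - y| < q%:R^-1.
Proof.
move=> q0; rewrite !ler_norml => /andP[x1 _] /andP[y1 _] xy.
have q0' : 0 < q%:R :> R by rewrite ltr0n.
have hx : 0 <= (x + 1) * q%:R by rewrite mulr_ge0// -lerBlDr sub0r.
have hy : 0 <= (y + 1) * q%:R by rewrite mulr_ge0// -lerBlDr sub0r.
have := truncn_itv hx; have := truncn_itv hy.
rewrite -/(cell q x) -/(cell q y) xy -natr1 => /andP[h1 h2] /andP[h3 h4].
rewrite -[ltRHS]mul1r ltr_pdivlMr// -[X in _ * X](gtr0_norm q0') -normrM.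
rewrite ltr_norml; apply/andP; split; lra.
Qed.

(** Dirichlet's pigeonhole argument: two exponents [i < j] place the real and imaginary parts of
    every [lam k] in the same cells, and [|lam k ^+ (j - i) - 1| = |lam k ^+ i - lam k ^+ j|]
    because [lam k] is unimodular. *)
Lemma simultaneous_recurrence_gt0 (lam : nat -> C) (K : nat) (e : C) :
  (forall k, `|lam k| = 1) -> 0 < e ->
  exists2 n, (0 < n)%N & forall k, (k < K)%N -> `|lam k ^+ n - 1| < e.
Proof.
move=> lam1 /complex_gt0_Re[-> e0]; set r := complex.Re e in e0 *.
(* Cells narrower than [r / 2] in both coordinates give a distance below [r]. *)
pose q := (Num.trunc (2 / r)).+1.
have qr : q%:R^-1 < r / 2.
  by rewrite -[ltRHS]invrK ltf_pV2 ?posrE ?invr_gt0 ?divr_gt0// invf_div truncnS_gt.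
pose B := 'I_(2 * q).+1.
pose F := {ffun 'I_K -> B * B}.
pose f (m : 'I_(#|{: F}|).+1) : F := [ffun k : 'I_K =>
  (inord (cell q (complex.Re (lam k ^+ m))),
   inord (cell q (complex.Im (lam k ^+ m)))) : B * B].
have pow1 k m : `|lam k ^+ m| = 1 by rewrite normrX lam1 expr1n.
have close (i j : 'I_(#|{: F}|).+1) : (i < j)%N -> f i = f j ->
    forall k, (k < K)%N -> `|lam k ^+ (j - i) - 1| < r%:C%C.
  move=> ij fij k kK.
  have := congr1 (fun g : F => g (Ordinal kK)) fij; rewrite !ffunE /= => -[].
  have [ri1 ii1] := unimodular_Re_Im (pow1 k i).
  have [rj1 ij1] := unimodular_Re_Im (pow1 k j).
  move=> /(congr1 val); rewrite /= !inordK ?cell_le// => hre.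
  move=> /(congr1 val); rewrite /= !inordK ?cell_le// => him.
  have -> : `|lam k ^+ (j - i) - 1| = `|lam k ^+ i - lam k ^+ j|.
    rewrite -[LHS]mul1r -[X in X * _](pow1 k i) -normrM mulrBr mulr1 -exprD.
    by rewrite subnKC ?(ltnW ij)// distrC.
  apply: complex_norm_lt; apply: lt_trans qr.
    have -> : complex.Re (lam k ^+ i - lam k ^+ j) =
      complex.Re (lam k ^+ i) - complex.Re (lam k ^+ j) by case: (_ ^+ i); case: (_ ^+ j).
    exact: cell_eq.
  have -> : complex.Im (lam k ^+ i - lam k ^+ j) =
    complex.Im (lam k ^+ i) - complex.Im (lam k ^+ j) by case: (_ ^+ i); case: (_ ^+ j).
  exact: cell_eq.
have /injectivePn[i [j ij fij]] : ~~ injectiveb f.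
  by apply/negP => /injectiveP/leq_card; rewrite card_ord ltnn.
move: ij; rewrite neq_ltn => /orP[ij|ij].
  by exists (j - i)%N; [rewrite subn_gt0|exact: close].
by exists (i - j)%N; [rewrite subn_gt0|exact: close].
Qed.

(** Recurrence of the powers [lam k ^+ N.+1] yields a positive multiple of [N.+1], hence an exponent
    beyond [N]. *)
Lemma simultaneous_recurrence (lam : nat -> C) (K N : nat) (e : C) :
  (forall k, `|lam k| = 1) -> 0 < e ->
  exists2 n, (N < n)%N & forall k, (k < K)%N -> `|lam k ^+ n - 1| < e.
Proof.
move=> lam1 e0.
have [|n n0 hn] := @simultaneous_recurrence_gt0 (fun k => lam k ^+ N.+1) K _ _ e0.
  by move=> k; rewrite normrX lam1 expr1n.
by exists (N.+1 * n)%N => [|k kK]; [rewrite leq_pmulr|rewrite exprM hn].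
Qed.

(** A filter on the circle: it equals [1] at [mu = 1] and tends to [0] at every other point. *)
Definition cesaro (N : nat) (mu : C) : C := N.+1%:R^-1 * \sum_(m < N.+1) mu ^+ m.

Lemma cesaro1 N : cesaro N 1 = 1.
Proof.
rewrite /cesaro (eq_bigr (fun=> 1)) => [|i _]; last by rewrite expr1n.
by rewrite sumr_const card_ord mulVf ?pnatr_eq0.
Qed.

Lemma norm_cesaro_le1 N mu : `|mu| = 1 -> `|cesaro N mu| <= 1.
Proof.
move=> mu1; rewrite normrM normfV normr_nat ler_pdivrMl ?ltr0n// mulr1.
apply: le_trans (ler_norm_sum _ _ _) _.
rewrite (eq_bigr (fun=> 1)) => [|i _]; last by rewrite normrX mu1 expr1n.
by rewrite sumr_const card_ord.
Qed.

(** The geometric sum times [mu - 1] is [mu ^+ N.+1 - 1], of modulus at most 2. *)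
Lemma norm_cesaro_le N mu : `|mu| = 1 -> mu != 1 ->
  `|cesaro N mu| <= N.+1%:R^-1 * (2 / `|mu - 1|).
Proof.
move=> mu1 mun1; rewrite normrM normfV normr_nat ler_pM2l ?invr_gt0 ?ltr0n//.
rewrite ler_pdivlMr ?normr_gt0 ?subr_eq0// mulrC -normrM -subrX1.
by apply: le_trans (ler_normB _ _) _; rewrite normrX mu1 expr1n normr1.
Qed.

Lemma cesaro_cvg0 (mu : nat -> C) (J : pred nat) (K : nat) (e : C) :
  (forall k, J k -> `|mu k| = 1 /\ mu k != 1) -> 0 < e ->
  exists N, forall k, (k < K)%N -> J k -> `|cesaro N (mu k)| < e.
Proof.
move=> hmu e0.
(* The induction on [K] takes a maximum of thresholds, so the bound must hold for all large [n]. *)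
suff [N hN] : exists N, forall n, (N <= n)%N ->
    forall k, (k < K)%N -> J k -> `|cesaro n (mu k)| < e by exists N; exact: hN.
elim: K => [|K [N hN]]; first by exists 0%N.
have [JK|nJK] := boolP (J K); last first.
  exists N => n Nn k; rewrite ltnS leq_eqVlt => /predU1P[->|]; last exact: hN.
  by rewrite (negbTE nJK).
have [m1 mn1] := hmu _ JK.
have d0 : 0 < `|mu K - 1| / 2 * e.
  by rewrite mulr_gt0// divr_gt0// normr_gt0 subr_eq0.
have [M hM] := exists_invn_lt d0.
exists (maxn N M) => n; rewrite geq_max => /andP[Nn Mn] k.
rewrite ltnS leq_eqVlt => /predU1P[-> _|]; last exact: hN.
apply: le_lt_trans (norm_cesaro_le n m1 mn1) _.
rewrite -ltr_pdivlMr ?divr_gt0 ?normr_gt0 ?subr_eq0// mulrC invf_div.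
apply: le_lt_trans hM; rewrite lef_pV2 ?posrE ?ltr0n// ler_nat//.
Qed.

End UnimodularNumbers.

(** * Limits of sequences *)

Section SequenceLimits.
Context {X : topologicalType}.

Lemma cvg_seqP (f : nat -> X) (x : X) : (f n @[n --> \oo] --> x) <->
  (forall U, nbhs x U -> exists N, forall n, (N <= n)%N -> U (f n)).
Proof.
split=> h U /h; first by case=> N _ hN; exists N => n Nn; exact: hN.
by case=> N hN; exists N.
Qed.

End SequenceLimits.

(** * Continuous linear operators *)

Section ContinuousLinear.
Context {K : numFieldType} {X : tvsType K}.

(** A predicate on plain functions, so that iterates, differences and averages of [T] need no
    bundling. *)
Definition contlin (P : X -> X) := continuous P /\ linear P.

Lemma contlinD P x y : contlin P -> P (x + y) = P x + P y.
Proof. by move=> [_ /(_ 1 x y)]; rewrite !scale1r. Qed.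

Lemma contlin0 P : contlin P -> P 0 = 0.
Proof. by move=> hP; apply: (addrI (P 0)); rewrite -contlinD// !addr0. Qed.

Lemma contlinZ P a x : contlin P -> P (a *: x) = a *: P x.
Proof. by move=> hP; have [_ /(_ a x 0)] := hP; rewrite !addr0 contlin0// addr0. Qed.

Lemma contlin_sum P (v : nat -> X) m n : contlin P ->
  P (\sum_(m <= k < n) v k) = \sum_(m <= k < n) P (v k).
Proof. by move=> hP; apply: big_morph => [y z|]; [exact: contlinD|exact: contlin0]. Qed.

Lemma contlin_id : contlin id.
Proof. by split=> [x|a x y] //; exact: cvg_id. Qed.

Lemma contlin_comp P Q : contlin P -> contlin Q -> contlin (P \o Q).
Proof.
move=> [cP lP] [cQ lQ]; split; last by move=> a x y /=; rewrite lQ lP.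
by move=> x; apply: continuous_comp; [exact: cQ|exact: cP].
Qed.

Lemma contlin_iter P n : contlin P -> contlin (iter n P).
Proof.
move=> hP; elim: n => [|n IH]; first exact: contlin_id.
exact: contlin_comp hP IH.
Qed.

Lemma contlin_add P Q : contlin P -> contlin Q -> contlin (fun x => P x + Q x).
Proof.
move=> [cP lP] [cQ lQ]; split; last first.
  by move=> a x y /=; rewrite lQ lP scalerDr addrACA.
move=> x; apply: (@continuous_comp _ _ _ (fun x => (P x, Q x)) (fun z : X * X => z.1 + z.2)).
  by apply: cvg_pair; [exact: cP|exact: cQ].
exact: add_continuous.
Qed.

Lemma contlin_scale a P : contlin P -> contlin (fun x => a *: P x).
Proof.
move=> [cP lP]; split; last first.
  by move=> b x y /=; rewrite lP scalerDr !scalerA mulrC.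
move=> x; apply: (@continuous_comp X (K^o * X)%type X (fun x => (a, P x)) (fun z => z.1 *: z.2)).
  by apply: (@cvg_pair _ _ _ _ (nbhs (a : K^o))); [exact: cvg_cst|exact: cP].
exact: scale_continuous.
Qed.

Lemma contlin_opp P : contlin P -> contlin (fun x => - P x).
Proof.
by move=> /(contlin_scale (-1)); under eq_fun do rewrite scaleN1r.
Qed.

Lemma contlin_bigsum n (P : nat -> X -> X) : (forall i, contlin (P i)) ->
  contlin (fun x => \sum_(i < n) P i x).
Proof.
move=> hP; elim: n => [|n IH].
  under eq_fun do rewrite big_ord0.
  by split; [move=> x; exact: cvg_cst|move=> a x y; rewrite scaler0 addr0].
by under eq_fun do rewrite big_ord_recr; exact: contlin_add.
Qed.

Lemma iter_eigen (T : X -> X) (l : K) v n : contlin T -> T v = l *: v ->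
  iter n T v = l ^+ n *: v.
Proof.
move=> hT Tv; elim: n => [|n IH]; first by rewrite scale1r.
by rewrite iterS IH contlinZ// Tv scalerA exprSr.
Qed.

End ContinuousLinear.

(** * Orbits of a series of eigenvectors *)

Section EigenvectorSeries.
Context {R : realType} {X : tvsType R[i]}.
Local Notation C := R[i].
Context (T : X -> X) (hT : contlin T) (lam : nat -> C) (u : nat -> X) (x : X).
Context (lam1 : forall k, `|lam k| = 1) (Tu : forall k, T (u k) = lam k *: u k).
Context (ux : (fun M => \sum_(0 <= k < M) u k) @ \oo --> x).
(** The bound 2 is the one satisfied by all the multipliers [lam k ^+ n - 1]. *)
Context (tail : forall U, nbhs (0 : X) U -> exists K0, forall K M, (K0 <= K)%N ->
  forall a : nat -> C, (forall k, `|a k| <= 2) -> U (\sum_(K <= k < M) a k *: u k)).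

(** [P x] is the limit of [P] on partial sums, and [tail] controls the block beyond [K]. The
    threshold does not depend on [P], so [K] can be fixed before the power of [T] is chosen. *)
Lemma diagonal_tail U : nbhs (0 : X) U -> exists K0, forall K, (K0 <= K)%N ->
  forall P (a : nat -> C), contlin P -> (forall k, P (u k) = a k *: u k) ->
    (forall k, `|a k| <= 2) -> U (P x - \sum_(0 <= k < K) a k *: u k).
Proof.
move=> /nbhs0_add[V V0 VU]; have [K0 hK0] := tail V0.
exists K0 => K K0K P a hP Pu a2.
have hV : nbhs (P x) [set y | V (P x - y)].
  apply/nbhs_translate => /=; have := nbhs0N V0; apply: filterS => _ [z Vz <-] /=.
  by rewrite opprD opprK addNKr.
have [cP _] := hP.
have [N hN] := (cvg_seqP _ _).1 ux _ (cP x _ hV).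
set M := maxn N K.
have -> : P x - \sum_(0 <= k < K) a k *: u k =
    (P x - P (\sum_(0 <= k < M) u k)) + \sum_(K <= k < M) a k *: u k.
  have -> : P (\sum_(0 <= k < M) u k) = \sum_(0 <= k < M) a k *: u k.
    by rewrite contlin_sum//; apply: eq_bigr.
  by rewrite (@big_cat_nat _ _ _ K 0 M)//= ?leq_maxr// opprD addrA addrNK.
apply: VU; last exact: hK0.
exact: (hN M (leq_maxl _ _)).
Qed.

(** The tail is controlled uniformly in [n] first; simultaneous recurrence of the remaining [K]
    eigenvalues then selects [n]. *)
Lemma eigen_series_returns U N : nbhs x U -> exists2 n, (N < n)%N & U (iter n T x).
Proof.
move=> /nbhs_translate/nbhs0_add[V V0 VU].
have [K hK] := diagonal_tail V0.
have [d d0 hd] := nbhs0_sum_small u K V0.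
have [n Nn hn] := simultaneous_recurrence K N lam1 d0.
exists n => //.
have -> : iter n T x = x + ((iter n T x - x - \sum_(0 <= k < K) (lam k ^+ n - 1) *: u k) +
    \sum_(0 <= k < K) (lam k ^+ n - 1) *: u k) by rewrite subrK addrC subrK.
apply: VU; last exact: hd.
apply: (hK K (leqnn K) (fun y => iter n T y - y)) => [|k|k].
- by apply: contlin_add; [exact: contlin_iter|exact: contlin_opp contlin_id].
- by rewrite (iter_eigen _ hT (Tu k)) scalerBl scale1r.
- by apply: le_trans (ler_normB _ _) _; rewrite normrX lam1 expr1n normr1.
Qed.

(** Indices with [u k = 0] are placeholders, at which values of [lam] may repeat. *)
Context (lam_inj : forall j k, u j != 0 -> u k != 0 -> lam j = lam k -> j = k).

(* The Cesaro means of [lam j ^- m *: T ^ m], applied to [T ^ n x - x], isolate the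
   term of index [j] uniformly in [n], since all multipliers [lam k ^+ n - 1] are
   bounded by 2. *)
Lemma eigen_series_coord (w : nat -> nat) j : hausdorff_space X -> u j != 0 ->
  (fun n => iter (w n) T x) @ \oo --> x ->
  forall e, 0 < e -> exists N, forall n, (N <= n)%N -> `|lam j ^+ w n - 1| < e.
Proof.
move=> hX uj0 wx; apply: (scaled_seq_cvg0 hX uj0) => U.
move=> /nbhs0_add[V V0 VU]; have [V1 V10 V1V] := nbhs0_add V0.
have V1N := nbhs0N V10.
have [K0 hK0] := diagonal_tail V1N; set K := maxn K0 j.+1.
have [d d0 hd] := nbhs0_sum_small u K V1N.
have lj0 : lam j != 0 by rewrite -normr_gt0 lam1.
have lj1 : `|(lam j)^-1| = 1 by rewrite normfV lam1 invr1.
(* The terms to be damped: their eigenvalues differ from [lam j], and placeholders contribute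
   nothing. *)
pose J k := (k != j) && (u k != 0).
(* The tolerance is [d / 2] because the other factor [lam k ^+ w n - 1] can reach modulus 2. *)
have [|N hN] := @cesaro_cvg0 _ (fun k => (lam j)^-1 * lam k) J K (d / 2) _ (divr_gt0 d0 (ltr0n _ 2)).
  move=> k /andP[kj uk]; rewrite normrM lj1 lam1 mulr1; split=> //.
  apply: contra kj => /eqP h; apply/eqP/lam_inj => //.
  by apply: (mulfI (invr_neq0 lj0)); rewrite h mulVf.
(* [N] is fixed before [n], so [Q] is a single continuous operator; it is diagonal on the [u k] and
   fixes [u j]. *)
pose Q y := N.+1%:R^-1 *: \sum_(m < N.+1) (lam j)^-1 ^+ m *: iter m T y.
have hQ : contlin Q.
  apply: contlin_scale.
  apply: (contlin_bigsum _ (P := fun m y => (lam j)^-1 ^+ m *: iter m T y)) => m.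
  exact/contlin_scale/contlin_iter.
have Qu k : Q (u k) = cesaro N ((lam j)^-1 * lam k) *: u k.
  rewrite /Q /cesaro -scalerA scaler_suml; congr (_ *: _).
  by apply: eq_bigr => m _; rewrite (iter_eigen _ hT (Tu k)) scalerA exprMn.
have Q0 : nbhs (0 : X) (Q @^-1` V).
  by have [cQ _] := hQ; apply: (cQ 0); rewrite contlin0.
have [N1 hN1] : exists N, forall n, (N <= n)%N -> V (Q (iter (w n) T x - x)).
  have h : nbhs x [set y | V (Q (y - x))].
    by apply/nbhs_translate; apply: filterS Q0 => z /=; rewrite addrC addKr.
  by have [N1 hN1] := (cvg_seqP _ _).1 wx _ h; exists N1.
exists N1 => n /hN1 hn.
pose b k := cesaro N ((lam j)^-1 * lam k) * (lam k ^+ w n - 1).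
have w2 k : `|lam k ^+ w n - 1| <= 2.
  by apply: le_trans (ler_normB _ _) _; rewrite normrX lam1 expr1n normr1.
have c1 k : `|cesaro N ((lam j)^-1 * lam k)| <= 1.
  by apply: norm_cesaro_le1; rewrite normrM lj1 lam1 mulr1.
have hPx : (-%R @` V1) (Q (iter (w n) T x - x) - \sum_(0 <= k < K) b k *: u k).
  apply: (hK0 K (leq_maxl _ _) (fun y => Q (iter (w n) T y - y))) => [|k|k].
  - apply: (contlin_comp hQ (Q := fun y => iter (w n) T y - y)).
    by apply: contlin_add; [exact: contlin_iter|exact: contlin_opp contlin_id].
  - rewrite (iter_eigen _ hT (Tu k)) -{2}(scale1r (u k)) -scalerBl contlinZ// Qu scalerA.
    by rewrite /b mulrC.
  - by rewrite normrM -[leRHS]mul1r ler_pM.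
have hrest : (-%R @` V1) (\sum_(0 <= k < K) (if J k then b k else 0) *: u k).
  apply: hd => k kK; case: ifPn => [Jk|_]; last by rewrite normr0.
  rewrite normrM -(divfK (_ : 2 != 0) d) ?pnatr_eq0//.
  by apply: le_lt_trans (ler_wpM2l (normr_ge0 _) (w2 k)) _; rewrite ltr_pM2r ?ltr0n// hN.
have split_sum : \sum_(0 <= k < K) b k *: u k =
    (lam j ^+ w n - 1) *: u j + \sum_(0 <= k < K) (if J k then b k else 0) *: u k.
  have jK : j \in index_iota 0 K by rewrite mem_index_iota leq0n /= leq_maxr.
  rewrite (bigD1_seq j)//= ?iota_uniq// {1}/b mulVf// cesaro1 mul1r; congr (_ + _).
  rewrite [RHS](bigD1_seq j)//= ?iota_uniq// /J eqxx /= scale0r add0r.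
  apply: eq_bigr => k /negbTE ->/=; case: eqVneq => [->|//].
  by rewrite !scaler0.
(* Three small pieces: the image under [Q], the tail beyond [K], and the damped terms below [K]. *)
have -> : (lam j ^+ w n - 1) *: u j = Q (iter (w n) T x - x) +
    (- (Q (iter (w n) T x - x) - \sum_(0 <= k < K) b k *: u k)
     - \sum_(0 <= k < K) (if J k then b k else 0) *: u k).
  by rewrite split_sum opprB [in RHS]addrAC addrK [RHS]addrC subrK.
case: hPx => p Vp <-; case: hrest => q Vq <-; rewrite !opprK.
by apply: VU => //; exact: V1V.
Qed.

End EigenvectorSeries.

(** * Reduction to countably many distinct eigenvalues *)

Section CountableEigenfamily.
Context {R : realType} {X : tvsType R[i]}.
Local Notation C := R[i].

Lemma closure_setTP (A : set X) :
  closure A = setT <-> forall (x : X) U, nbhs x U -> exists2 y, A y & U y.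
Proof.
split=> [h x U Ux|h].
  have Ax : closure A x by rewrite h.
  by have [y [Ay Uy]] := Ax U Ux; exists y.
by apply/seteqP; split=> // x _ U /h[y Ay Uy]; exists y.
Qed.

Lemma separable_seq : @separable _ X ->
  exists D : nat -> X, forall (x : X) U, nbhs x U -> exists n, U (D n).
Proof.
move=> [D [/pfcard_geP[D0|/unsquash f] hD]].
  by have [y] := (closure_setTP D).1 hD 0 setT (filterT); rewrite D0.
exists f => x U xU; have [y Dy Uy] := (closure_setTP D).1 hD x U xU.
by have [n _ fn] := @surj _ _ _ _ f y Dy; exists n; rewrite fn.
Qed.

Lemma lspan_mono (A B : set X) : A `<=` B -> lspan A `<=` lspan B.
Proof. by move=> AB x [n [c [v [hv ->]]]]; exists n, c, v; split=> // i; exact: AB. Qed.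

Lemma lspan_unimod_seq (T : X -> X) (z : X) : lspan (unimod_eigenvectors T) z ->
  exists l : nat -> C, (forall i, `|l i| = 1) /\
    lspan [set v | exists i, T v = l i *: v] z.
Proof.
move=> [n [c [v [/choice[l hl] ->]]]].
exists (fun i => if insub i is Some j then l j else 1); split=> [i|].
  by case: insubP => [j _ _|_]; [exact: (hl j).1|exact: normr1].
exists n, c, v; split=> // i; exists (val i); rewrite valK.
exact: (hl i).2.
Qed.

(** Each pair of a dense point [D m] and a basic entourage [f n] is served by one vector of the
    span, which involves finitely many eigenvalues; the countably many lists are merged by [pickle],
    with the unimodular default [1]. *)
Lemma countable_eigenvalues (T : X -> X) :
  countable_uniformity X -> @separable _ X ->
  closure (lspan (unimod_eigenvectors T)) = setT ->
  exists lam : nat -> C, (forall k, `|lam k| = 1) /\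
    closure (lspan [set v | exists k, T v = lam k *: v]) = setT.
Proof.
move=> /countable_uniformityP[f fbase fent] /separable_seq[D hD] /closure_setTP hT.
have /choice[g hg] (p : nat * nat) : exists g : nat -> C, (forall i, `|g i| = 1) /\
    exists2 z, lspan [set v | exists i, T v = g i *: v] z & f p.2 (D p.1, z).
  have [z /lspan_unimod_seq[l [l1 lz]] /xsectionP fz] := hT _ _ (nbhs_entourage (D p.1) (fent p.2)).
  by exists l; split=> //; exists z.
exists (fun k => if @unpickle (nat * nat * nat)%type k is Some (p, i) then g p i else 1).
split=> [k|].
  by case: unpickle => [[p i]|]; [exact: (hg p).1|exact: normr1].
apply/closure_setTP => x U /nbhsP[E entE EU].
pose E' := split_ent E.
have entE' : entourage E' by exact: entourage_split_ent.
have [n fn] := fbase _ entE'.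
have [m /xsectionP hm] := hD _ _ (nbhs_entourage x entE').
have [_ [z hz fz]] := hg (m, n).
exists z; last by apply/EU/xsectionP; exact: (entourage_split (D m)) (fn _ fz).
apply: lspan_mono hz => v [i Tv]; exists (pickle ((m, n), i)).
by rewrite pickleK.
Qed.

(** [e] only marks the indices in use: [y k] need not be a multiple of [e k], since eigenspaces may
    have any dimension. *)
Definition eigen_decomposition (T : X -> X) (lam : nat -> C) (e : nat -> X)
    (z : X) (y : nat -> X) (K : nat) :=
  [/\ forall k, T (y k) = lam k *: y k, forall k, e k = 0 -> y k = 0,
      forall k, (K <= k)%N -> y k = 0 & z = \sum_(0 <= k < K) y k].

Lemma sum_eventually0 (y : nat -> X) K M : (K <= M)%N ->
  (forall k, (K <= k)%N -> y k = 0) ->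
  \sum_(0 <= k < M) y k = \sum_(0 <= k < K) y k.
Proof.
move=> KM y0; rewrite (@big_cat_nat _ _ _ K 0 M)//= [X in _ + X]big_nat_cond [X in _ + X]big1 ?addr0//.
by move=> k /andP[/andP[Kk _] _]; exact: y0.
Qed.

(** Vectors sharing an eigenvalue are gathered at the index that represents it. *)
Lemma eigen_decomposition_span (T : X -> X) (lam : nat -> C) (e : nat -> X) (z : X) :
  contlin T ->
  (forall v k, T v = lam k *: v -> v != 0 -> exists2 k', lam k' = lam k & e k' != 0) ->
  lspan [set v | exists k, T v = lam k *: v] z ->
  exists y K, eigen_decomposition T lam e z y K.
Proof.
move=> hT he [n [c [v [hv ->]]]].
elim/big_ind: _ => [|a b [ya [Ka [a1 a2 a3 ->]]] [yb [Kb [b1 b2 b3 ->]]]|i _].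
- by exists (fun=> 0), 0%N; split=> [k|//|//|]; [rewrite contlin0// scaler0|rewrite big_geq].
- exists (fun k => ya k + yb k), (maxn Ka Kb); split=> [k|k ek|k|].
  + by rewrite contlinD// a1 b1 scalerDr.
  + by rewrite a2 ?b2 ?addr0.
  + by rewrite geq_max => /andP[Kak Kbk]; rewrite a3 ?b3 ?addr0.
  + by rewrite big_split /= !(sum_eventually0 _ a3, sum_eventually0 _ b3) ?leq_maxl ?leq_maxr.
- have [k Tv] := hv i.
  have [v0|v0] := eqVneq (v i) 0.
    by exists (fun=> 0), 0%N; split=> [j|//|//|]; [rewrite contlin0// scaler0|rewrite big_geq// v0 scaler0].
  have [j jk ej] := he _ _ Tv v0.
  exists (fun k => if k == j then c i *: v i else 0), j.+1; split=> [l|l|l|].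
  + case: eqVneq => [->|_]; last by rewrite contlin0 ?scaler0.
    by rewrite contlinZ// Tv jk !scalerA mulrC.
  + by case: eqVneq => [-> /eqP|//]; rewrite (negbTE ej).
  + by case: eqVneq => [->|//]; rewrite ltnn.
  + rewrite big_nat_recr //= eqxx big_nat_cond big1 ?add0r// => l /andP[/andP[_ lj] _].
    by rewrite ltn_eqF.
Qed.

(** [e k] is nonzero only if [lam k] has an eigenvector and [k] is the first index at which that
    value occurs. *)
Lemma distinct_eigenvectors (T : X -> X) (lam : nat -> C) : contlin T ->
  exists e : nat -> X,
    [/\ forall k, T (e k) = lam k *: e k,
        forall j k, e j != 0 -> e k != 0 -> lam j = lam k -> j = k &
        forall v k, T v = lam k *: v -> v != 0 -> exists2 k', lam k' = lam k & e k' != 0].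
Proof.
move=> hT; pose first_idx k := forall j, (j < k)%N -> lam j <> lam k.
have /choice[e he] k : exists v : X, [/\ T v = lam k *: v, v != 0 -> first_idx k &
    first_idx k -> forall v', T v' = lam k *: v' -> v' != 0 -> v != 0].
  have [hk|hk] := pselect (first_idx k /\ exists2 v', T v' = lam k *: v' & v' != 0).
    by have [? [v Tv v0]] := hk; exists v; split.
  exists 0; split; [by rewrite contlin0 ?scaler0|by rewrite eqxx|].
  by move=> fk v' Tv' v'0; exfalso; apply: hk; split=> //; exists v'.
exists e; split=> [k|j k ej ek jk|v k Tv v0].
- by have [] := he k.
- have [_ /(_ ej) fj _] := he j; have [_ /(_ ek) fk _] := he k.
  by case: (ltngtP j k) => // [/fk|/fj]; rewrite jk.
- have exk : exists j, `[< lam j = lam k >] by exists k; apply/asboolP.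
  case: (ex_minnP exk) => j /asboolP jk jmin; exists j => //.
  have [_ _] := he j; apply; last exact: v0; last by rewrite jk.
  move=> i ij ijE; have := jmin i; rewrite leqNgt ij.
  by move=> /(_ (introT (asboolP _) (etrans ijE jk))).
Qed.

End CountableEigenfamily.

(** * Construction of eigenvector series and of return times *)

Section Construction.
Context {R : realType} {X : tvsType R[i]}.
Local Notation C := R[i].

(** With such a base, a sum whose [k]-th term lies in [V k.+1] stays in [V m] when it starts at
    [m]. *)
Lemma nbhs0_halving_base : countable_uniformity X ->
  exists V : nat -> set X, [/\ forall n, nbhs (0 : X) (V n),
    forall n a b, V n.+1 a -> V n.+1 b -> V n (a + b) &
    forall U, nbhs (0 : X) U -> exists n, V n `<=` U].
Proof.
move=> /countable_uniformityP[f fbase fent].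
have /choice[half hhalf] (U : set X) : exists V : set X, nbhs (0 : X) U ->
    nbhs (0 : X) V /\ forall a b, V a -> V b -> U (a + b).
  have [U0|U0] := pselect (nbhs (0 : X) U); last by exists U.
  by have [V V0 VU] := nbhs0_add U0; exists V.
pose W n := xsection (f n) (0 : X).
have W0 n : nbhs (0 : X) (W n) by exact: nbhs_entourage.
pose V := fix V n := if n is n'.+1 then half (V n') `&` W n else W 0%N.
have V0 n : nbhs (0 : X) (V n).
  elim: n => [|n IH]; first exact: W0.
  by apply: filterI (W0 _); exact: (hhalf _ IH).1.
exists V; split=> //.
  by move=> n a b [ha _] [hb _]; exact: (hhalf _ (V0 n)).2.
move=> U /nbhsP[E entE EU].
have [n fn] := fbase _ entE; exists n => v hv; apply/EU/xsectionP/fn/xsectionP.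
by case: n hv {fn} => [|n] // [].
Qed.

Lemma halving_decreasing (V : nat -> set X) :
  (forall n, nbhs (0 : X) (V n)) ->
  (forall n a b, V n.+1 a -> V n.+1 b -> V n (a + b)) ->
  forall m n, (m <= n)%N -> V n `<=` V m.
Proof.
move=> V0 Vadd m n /subnKC <-; elim: (n - m)%N => [|k IH]; first by rewrite addn0.
move=> v; rewrite addnS => hv; apply: IH; rewrite -[v]addr0; apply: Vadd => //.
exact: nbhs_singleton.
Qed.

(** Starting inside [E] keeps a sequence with controlled steps close to its first term. *)
Lemma entourage_halving_base (E : set (X * X)) : countable_uniformity X -> entourage E ->
  exists A : nat -> set (X * X), [/\ forall n, entourage (A n),
    forall n x y z, A n.+1 (x, y) -> A n.+1 (y, z) -> A n (x, z),
    A 0%N `<=` E & forall E', entourage E' -> exists n, A n `<=` E'].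
Proof.
move=> /countable_uniformityP[f fbase fent] entE.
pose A := fix A n := if n is n'.+1 then split_ent (A n') `&` f n else E `&` f 0%N.
have entA n : entourage (A n).
  elim: n => [|n IH]; first exact: filterI.
  by apply: filterI (fent _); exact: entourage_split_ent.
exists A; split=> //.
- by move=> n x y z [xy _] [yz _]; exact: (entourage_split y).
- by move=> p [].
- move=> E' entE'; have [n fn] := fbase _ entE'; exists n => p hp; apply: fn.
  by case: n hp => [|n] [].
Qed.

(** Steps are composed from the far end: a step and a remainder, both in [A m.+1], combine into
    [A m]. Hence the sequence is Cauchy. *)
Lemma controlled_seq_cvg (A : nat -> set (X * X)) (s : nat -> X) : @frechet _ X ->
  (forall n, entourage (A n)) ->
  (forall n x y z, A n.+1 (x, y) -> A n.+1 (y, z) -> A n (x, z)) ->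
  (forall E, entourage E -> exists n, A n `<=` E) ->
  (forall n, A n.+1 (s n, s n.+1)) ->
  (forall m n, (m <= n)%N -> A m (s m, s n)) /\ exists x : X, s @ \oo --> x.
Proof.
move=> [_ _ hcomplete] entA splitA baseA sA.
have sAmn m n : (m <= n)%N -> A m (s m, s n).
  move=> /subnKC <-; move: (n - m)%N => k; elim: k m => [|k IH] m.
    by rewrite addn0; exact: entourage_refl.
  by apply: splitA (sA m) _; rewrite -addSnnS; exact: IH.
split=> //; apply: hcomplete => E entE.
have entE' := entourage_invI (entourage_split_ent entE).
have [n hn] := baseA _ entE'.
pose P := [set p | A n (s n, p)].
have sP : (s @ \oo) P by exists n => // m; exact: sAmn.
exists (P, P) => // -[p q] /= [/hn[_ np] /hn[nq _]].
exact: (entourage_split (s n)).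
Qed.

Lemma small_multiple (v s : X) (V : set X) (E : set (X * X)) :
  nbhs (0 : X) V -> entourage E ->
  exists2 t : C, t != 0 & (forall a, `|a| <= 2 -> V (a *: (t *: v))) /\ E (s, s + t *: v).
Proof.
move=> V0 entE.
have h0 : nbhs (0 : X) (V `&` [set z | E (s, s + z)]).
  apply: filterI => //.
  have /nbhs_translate := nbhs_entourage s entE.
  by apply: filterS => z /= /xsectionP.
have [W W0 hW] := nbhs0_scale_bounded (ltr0n C 2) h0.
have [d d0 hd] := nbhs0_scale_small v W0.
have Wd : W ((d / 2) *: v).
  by apply: hd; rewrite gtr0_norm ?divr_gt0// ltr_pdivrMr// mulr_natr mulr2n ltrDl.
exists (d / 2); first by rewrite lt0r_neq0// divr_gt0.
split=> [a /hW/(_ Wd)[]//|].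
(* The multiplier [1] is among those bounded by 2, so the same [t] also meets the condition on
   [E]. *)
by have [_ /=] := hW 1 _ (eq_ind_r (fun r => r <= 2) (ler1n C 2) (normr1 C)) Wd; rewrite scale1r.
Qed.

(* The uniformity of a [tvsType] is not assumed translation invariant, so the terms
   are chosen recursively: each is small for a base of neighbourhoods of 0, which
   controls bounded multipliers, and small relative to the partial sum already
   reached, which makes the partial sums Cauchy. *)
Lemma eigen_series_near (T : X -> X) (lam : nat -> C) (e y : nat -> X) (z : X) (K : nat)
    (U : set X) :
  @frechet _ X -> contlin T -> (forall k, T (e k) = lam k *: e k) ->
  eigen_decomposition T lam e z y K -> nbhs z U ->
  exists (u : nat -> X) (x : X),
    [/\ (forall k, T (u k) = lam k *: u k), (forall k, (u k == 0) = (e k == 0)), U x,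
        (fun M => \sum_(0 <= k < M) u k) @ \oo --> x &
        forall U, nbhs (0 : X) U -> exists K0, forall K M, (K0 <= K)%N ->
          forall a : nat -> C, (forall k, `|a k| <= 2) -> U (\sum_(K <= k < M) a k *: u k)].
Proof.
move=> hF hT Te [Ty y_e yK ->]; set z' := \sum_(0 <= k < K) y k.
move=> /nbhsP[E entE EU].
have [_ hcu _] := hF.
have [V [V0 Vadd Vbase]] := nbhs0_halving_base hcu.
have [A [entA Asplit A0 Abase]] := entourage_halving_base hcu (entourage_split_ent entE).
have /choice[t ht] (p : nat * X) : exists t : C, t != 0 /\
    (forall a, `|a| <= 2 -> V p.1.+1 (a *: (t *: e p.1))) /\
    A p.1.+1 (p.2, p.2 + t *: e p.1).
  by have [t] := small_multiple (e p.1) p.2 (V0 p.1.+1) (entA p.1.+1); exists t.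
(* A nonzero multiple of [e k] is added only where [y k] vanishes, so that [u k] vanishes exactly
   when [e k] does. *)
pose d k s := if y k == 0 then t (k, s) *: e k else 0.
pose s := fix s n := if n is n'.+1 then s n' + d n' (s n') else z'.
pose dd k := d k (s k).
have sA n : A n.+1 (s n, s n.+1).
  rewrite /= /d; case: ifP => _; first exact: (ht (n, s n)).2.2.
  by rewrite addr0; exact: entourage_refl.
have [sAmn [x sx]] := controlled_seq_cvg hF entA Asplit Abase sA.
have Vdec := halving_decreasing V0 Vadd.
have Vdd k a : `|a| <= 2 -> V k.+1 (a *: dd k).
  rewrite /dd /d; case: ifP => _; first exact: (ht (k, s k)).2.1.
  by move=> _; rewrite scaler0; exact: nbhs_singleton.
have Vsum m n (a : nat -> C) : (forall k, `|a k| <= 2) ->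
    V m (\sum_(m <= k < n) a k *: dd k).
  move=> a2; have [nm|/ltnW mn] := leqP n m.
    by rewrite big_geq//; exact: nbhs_singleton.
  rewrite -(subnKC mn); move: (n - m)%N => k; elim: k m {mn} => [|k IH] m.
    by rewrite addn0 big_geq//; exact: nbhs_singleton.
  rewrite big_ltn ?addnS ?ltnS ?leq_addr//; apply: Vadd; first exact: Vdd.
  by rewrite -addSn; exact: IH.
pose u k := y k + dd k.
have ud k : (K <= k)%N -> u k = dd k by move=> /yK yk; rewrite /u yk add0r.
have sE n : s n = z' + \sum_(0 <= k < n) dd k.
  elim: n => [|n IH]; first by rewrite big_nil addr0.
  by rewrite big_nat_recr//= addrA -IH.
exists u, x; split.
- move=> k; rewrite /u /dd /d contlinD// Ty scalerDr; congr (_ + _).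
  case: ifP => _; last by rewrite contlin0 ?scaler0.
  by rewrite contlinZ// Te !scalerA mulrC.
- move=> k; rewrite /u /dd /d; case: ifPn => [/eqP yk|yk].
    by rewrite yk add0r scaler_eq0 (negbTE (ht (k, s k)).1).
  rewrite addr0 (negbTE yk); apply/esym/negbTE; apply: contra yk => /eqP ek.
  by rewrite y_e.
(* The limit lies only in the closure of a section of [A 0]; having [A 0] inside [split_ent E]
   absorbs this. *)
- apply: EU; apply: ent_closure => // B xB.
  have [N hN] := (cvg_seqP _ _).1 sx _ xB.
  by exists (s N); split; [apply/xsectionP/A0; exact: (sAmn 0%N)|exact: hN].
(* [s] starts from all of [z'], so it agrees with the partial sums of [u] only from [K] on. *)
- apply/cvg_seqP => B /((cvg_seqP _ _).1 sx)[N hN]; exists (maxn N K) => n.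
  rewrite geq_max => /andP[Nn Kn].
  by rewrite big_split /= (sum_eventually0 Kn yK) -sE; exact: hN.
- move=> B /Vbase[n hn]; exists (maxn n K) => m M; rewrite geq_max => /andP[nm Km] a a2.
  rewrite (_ : \sum_(m <= k < M) a k *: u k = \sum_(m <= k < M) a k *: dd k).
    by apply/hn/(Vdec _ _ nm)/Vsum.
  by apply: eq_big_nat => k /andP[mk _]; rewrite ud// (leq_trans Km).
Qed.

(** A diagonal choice along a countable base: the [n]-th time exceeds the previous one and returns
    into [V n]. *)
Lemma recurrent_of_returns (T : X -> X) (x : X) : countable_uniformity X ->
  (forall (U : set X) N, nbhs x U -> exists2 n, (N < n)%N & U (iter n T x)) -> Rec T x.
Proof.
move=> /nbhs0_halving_base[V [V0 Vadd Vbase]] hx.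
have Vx k : nbhs x [set y | V k (y - x)].
  by apply/nbhs_translate; apply: filterS (V0 k) => z /=; rewrite addrC addKr.
have /choice[g hg] (p : nat * nat) : exists n, (p.2 < n)%N /\ V p.1 (iter n T x - x).
  by have [n pn hn] := hx _ p.2 (Vx p.1); exists n.
pose w := fix w n := if n is n'.+1 then g (n, w n') else g (0%N, 0%N).
have wS n : (w n < w n.+1)%N by exact: (hg (_, _)).1.
have Vw n : V n (iter (w n) T x - x) by case: n => [|n]; exact: (hg (_, _)).2.
have Vdec := halving_decreasing V0 Vadd.
exists w; split; first split.
- by case=> [|n]; [exact: (hg (0, 0)%N).1|exact: leq_ltn_trans (wS n)].
- by move=> m n; apply: (homo_ltn ltn_trans wS).
- apply/cvg_seqP => U /nbhs_translate/Vbase[k hk]; exists k => n kn.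
  by have := hk _ (Vdec _ _ kn _ (Vw n)); rewrite /= addrC subrK.
Qed.

End Construction.

(** * Density of the hyper-recurrent vectors *)

Unset Implicit Arguments.

Theorem theorem5p12 (R : realType) (X : tvsType R[i])
  (hF : @frechet _ X) (hS : @separable _ X)
  (T : {linear X -> X}) (hT : continuous T)
  (hinv : exists S : X -> X, continuous S /\ cancel T S /\ cancel S T)
  (hdisc : closure (lspan (unimod_eigenvectors T)) = setT) :
  hyper_recurrent T /\ closure (Hr T) = setT.
Proof.
suff hHr : closure (Hr T) = setT.
  split=> //; split.
    apply/closure_setTP => x U xU.
    by have [y [ry _] Uy] := (closure_setTP _).1 hHr x U xU; exists y.
  by have [y hy _] := (closure_setTP _).1 hHr 0 setT filterT; exists y.
have [hX hcu _] := hF.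
have cT : contlin T by split=> // a x y; exact: linearP.
have [lam [lam1 hlam]] := countable_eigenvalues hcu hS hdisc.
have [e [Te e_inj he]] := distinct_eigenvectors lam cT.
(* Passing to the interior makes [U0] a neighbourhood of the approximating vector [z] as well. *)
apply/closure_setTP => x0 U0 /nbhs_interior x0U.
have [z /(eigen_decomposition_span cT he)[y [K hy]] Uz] := (closure_setTP _).1 hlam _ _ x0U.
have [u [x [Tu u_e Ux ux tail]]] := eigen_series_near hF cT Te hy Uz.
exists x => //; split.
  apply: recurrent_of_returns => // U N; exact: (eigen_series_returns cT lam1 Tu ux tail).
move=> w _ wx; apply/closure_setTP => v U vU.
have [z' /(eigen_decomposition_span cT he)[y' [K' [Ty' y'_e _ z'E]]] Uz'] :=
  (closure_setTP _).1 hlam _ _ vU.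
exists z' => //; apply/cvg_seqP => B /nbhs_translate B0.
have [d d0 hd] := nbhs0_sum_small y' K' B0.
have lamw k : e k != 0 -> exists N, forall n, (N <= n)%N -> `|lam k ^+ w n - 1| < d.
  move=> ek; apply: (eigen_series_coord cT lam1 Tu ux tail) => //; last by rewrite u_e.
  by move=> i j; rewrite !u_e; exact: e_inj.
(* Only the [K'] components of [z'] matter, so finitely many thresholds are merged. *)
have [N hN] : exists N, forall n, (N <= n)%N ->
    forall k, (k < K')%N -> e k != 0 -> `|lam k ^+ w n - 1| < d.
  elim: K' {z'E hd} => [|M [N hN]]; first by exists 0%N.
  have [eM|/lamw[N' hN']] := eqVneq (e M) 0.
    exists N => n Nn k; rewrite ltnS leq_eqVlt => /predU1P[->|]; last exact: hN.
    by rewrite eM eqxx.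
  exists (maxn N N') => n; rewrite geq_max => /andP[Nn N'n] k.
  by rewrite ltnS leq_eqVlt => /predU1P[-> _|]; [exact: hN'|exact: hN].
exists N => n /hN hn.
(* Where [e k = 0] the convergence [lam k ^+ w n] to 1 is unknown, but [y' k = 0] there and the
   multiplier can be set to 0. *)
have -> : iter (w n) T z' =
    z' + \sum_(0 <= k < K') (if e k == 0 then 0 else lam k ^+ w n - 1) *: y' k.
  rewrite z'E (contlin_sum _ _ _ (contlin_iter (w n) cT)) -big_split /=.
  apply: eq_bigr => k _; rewrite (iter_eigen _ cT (Ty' k)).
  case: eqVneq => [/y'_e ->|_]; first by rewrite !scaler0 addr0.
  by rewrite -{2}(scale1r (y' k)) -scalerDl addrC subrK.
apply: hd => k kK; case: eqVneq => [_|ek]; [by rewrite normr0|exact: hn].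
Qed.
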